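(* Let $\theta_1,\dots,\theta_m\in\Theta\subset\mathbb{R}^k$ and for each $i$ let $x^\ast(\theta_i)$ be an arbitrarily chosen element of $C^\ast(\theta_i)\subset\mathbb{R}^n$ (one element for each point $\theta_i$). Let $\mathcal{S}=\{S_1,\dots,S_d\}$ be a finite collection of subsets of $\{\theta_1,\dots,\theta_m\}$ such that (a) for each $j\in\{1,\dots,d\}$, $|S_j|=k+1$ and $\mathrm{Conv}(S_j)$ is a $k$-dimensional simplex; (b) $\mathrm{Conv}(\{\theta_1,\dots,\theta_m\})=\bigcup_{j=1}^d \mathrm{Conv}(S_j)$; (c) for every non-empty $J\subseteq\{1,\dots,d\}$, $\bigcap_{j\in J}\mathrm{Conv}(S_j)=\mathrm{Conv}\big(\bigcap_{j\in J}S_j\big)$. Write $S_j=\{\theta^j_1,\dots,\theta^j_{k+1}\}$. For $\theta\in \mathrm{Conv}(\{\theta_1,\dots,\theta_m\})$ let $j_\theta$ be an index with $\theta\in \mathrm{Conv}(S_{j_\theta})$, and let $\lambda^{j_\theta}_1,\dots,\lambda^{j_\theta}_{k+1}\ge 0$ with $\sum_{l=1}^{k+1}\lambda^{j_\theta}_l=1$ be the weights such that $\theta=\sum_{l=1}^{k+1}\lambda^{j_\theta}_l\theta^{j_\theta}_l$. Then the function $\hat{x}:\mathrm{Conv}(\{\theta_1,\dots,\theta_m\})\to\mathbb{R}^n$, $$\hat{x}(\theta)=\sum_{l=1}^{k+1}\lambda^{j_\theta}_l\,x^\ast(\theta^{j_\theta}_l),$$ is continuous.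
   Context: Parametric optimization problem: $\min_x f(x,\theta)$ subject to $x\in C(\theta)$, where $x\in X\subset\mathbb{R}^n$, $\theta\in\Theta\subset\mathbb{R}^k$, $f:\mathbb{R}^n\times\mathbb{R}^k\to\mathbb{R}$ is continuous on $X\times\Theta$, and $C$ is a correspondence assigning to each $\theta\in\Theta$ a non-empty compact set $C(\theta)\subseteq X$. Define $f^\ast(\theta)=\min_{x\in C(\theta)}f(x,\theta)$ and $C^\ast(\theta)=\{x\in C(\theta): f(x,\theta)=f^\ast(\theta)\}$, the (non-empty) set of optimal solutions. For a non-empty set $A\subset\mathbb{R}^p$ and $\varepsilon>0$, $\mathcal{B}_\varepsilon(A)=\{y\in\mathbb{R}^p:\exists x\in A,\ \|x-y\|<\varepsilon\}$ (Euclidean norm), and $\mathcal{B}_\delta(\theta_0)=\mathcal{B}_\delta(\{\theta_0\})$. It is a standing assumption that $C$ is continuous on $\Theta$: for every $\theta_0\in\Theta$ and $\varepsilon>0$ there is $\delta>0$ such that for all $\theta\in\Theta\cap\mathcal{B}_\delta(\theta_0)$, $C(\theta)\subset\mathcal{B}_\varepsilon(C(\theta_0))$ and $C(\theta_0)\subset\mathcal{B}_\varepsilon(C(\theta))$. $\mathrm{Conv}$ denotes the convex hull, with $\mathrm{Conv}(\emptyset)=\emptyset$. *)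

(* Defs.v *)
From HB Require Import structures.
From mathcomp Require Import all_boot all_order all_algebra.
From mathcomp Require Import all_classical all_reals all_analysis.

Set Implicit Arguments.
Unset Strict Implicit.
Unset Printing Implicit Defensive.

Import Order.TTheory GRing.Theory Num.Theory.
Import numFieldNormedType.Exports.

Local Open Scope classical_set_scope.
Local Open Scope ring_scope.

(* The library norm `|x| on row vectors is the sup norm; it induces the same
   topology, but the neighbourhoods of sets below use the Euclidean norm. *)
Definition enorm (R : realType) (p : nat) (x : 'rV[R]_p) : R :=
  Num.sqrt (\sum_(i < p) x ord0 i ^+ 2).

Definition eball_set (R : realType) (p : nat) (e : R) (A : set 'rV[R]_p) :
    set 'rV[R]_p :=
  [set y | exists2 x, A x & enorm (x - y) < e].

Definition continuous_correspondence (R : realType) (n k : nat)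
    (Theta : set 'rV[R]_k) (C : 'rV[R]_k -> set 'rV[R]_n) : Prop :=
  forall t0, Theta t0 -> forall e : R, 0 < e ->
    exists2 dlt : R, 0 < dlt &
      forall t, (Theta `&` eball_set dlt [set t0]) t ->
        C t `<=` eball_set e (C t0) /\ C t0 `<=` eball_set e (C t).

(* When C t is non-empty and compact and f is continuous, the infimum is
   attained, so this is the minimum of f(., t) over C t. *)
Definition opt_value (R : realType) (n k : nat) (f : 'rV[R]_n * 'rV[R]_k -> R)
    (C : 'rV[R]_k -> set 'rV[R]_n) (t : 'rV[R]_k) : R :=
  inf [set f (x, t) | x in C t].

Definition opt_set (R : realType) (n k : nat) (f : 'rV[R]_n * 'rV[R]_k -> R)
    (C : 'rV[R]_k -> set 'rV[R]_n) (t : 'rV[R]_k) : set 'rV[R]_n :=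
  [set x | C t x /\ f (x, t) = opt_value f C t].

(* The empty set is convex, so conv_hull set0 = set0. *)
Definition conv_hull (R : realType) (p : nat) (A : set 'rV[R]_p) :
    set 'rV[R]_p :=
  smallest (@convex_set R 'rV[R]_p) A.

Definition affinely_independent (R : realType) (p q : nat)
    (v : 'I_q -> 'rV[R]_p) : Prop :=
  forall c : 'I_q -> R, \sum_i c i = 0 -> \sum_i c i *: v i = 0 ->
    forall i, c i = 0.

Definition is_simplex (R : realType) (p q : nat) (A : set 'rV[R]_p) : Prop :=
  exists2 v : 'I_q.+1 -> 'rV[R]_p,
    affinely_independent v & A = conv_hull (range v).

(* Main.v *)
Require Import Defs.
From HB Require Import structures.
From mathcomp Require Import all_boot all_order all_algebra.
From mathcomp Require Import all_classical all_reals all_analysis.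

(* On each simplex Conv(S_j) the function agrees with an affine map g_j defined
   on all of R^k.  Two such maps g_i and g_j agree on the common vertices of S_i
   and S_j; since the set where two affine maps coincide is convex, (c) makes
   them agree on Conv(S_i) `&` Conv(S_j).  Continuity then follows by pasting
   over the finite closed cover of the domain by the Conv(S_j). *)

Set Implicit Arguments.
Unset Strict Implicit.
Unset Printing Implicit Defensive.

Import Order.TTheory GRing.Theory Num.Theory.
Import numFieldNormedType.Exports.

Local Open Scope classical_set_scope.
Local Open Scope card_scope.
Local Open Scope ring_scope.

Lemma conv_hull_sub (R : realType) (p : nat) (A B : set 'rV[R]_p) :
  A `<=` B -> convex_set B -> conv_hull A `<=` B.
Proof. by move=> AB cB; apply: smallest_sub. Qed.

Lemma sub_conv_hull (R : realType) (p : nat) (A : set 'rV[R]_p) :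
  A `<=` conv_hull A.
Proof. exact: sub_smallest. Qed.

Lemma conv_hull_convex (R : realType) (p : nat) (A : set 'rV[R]_p) :
  convex_set (conv_hull A).
Proof.
move=> x y a /[!inE] xA yA B [cB AB].
by apply/set_mem/cB; rewrite inE; [exact: xA|exact: yA].
Qed.

(** [convex_set] only speaks of two points, so the first point is peeled off by induction and the
    others are averaged after dividing their weights by their total [s]. *)
Lemma convex_set_sum (R : realType) (p q : nat) (A : set 'rV[R]_p)
    (w : 'I_q -> 'rV[R]_p) (c : 'I_q -> R) :
  convex_set A -> (forall l, A (w l)) -> (forall l, 0 <= c l) ->
  \sum_l c l = 1 -> A (\sum_l c l *: w l).
Proof.
move=> cA; elim: q w c => [|q IHq] w c Aw c0.
  by rewrite big_ord0 => /esym/eqP; rewrite oner_eq0.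
rewrite !big_ord_recl; set s := \sum_(i < q) _ => cs.
have s0 : 0 <= s by apply: sumr_ge0.
(* Rescaling by [s] needs [s != 0]; otherwise all remaining weights vanish and the sum is the first
   point. *)
have [s_eq0|s_neq0] := eqVneq s 0.
  have -> : \sum_(i < q) c (lift ord0 i) *: w (lift ord0 i) = 0.
    apply: big1 => i _.
    have /eqP := s_eq0; rewrite psumr_eq0 // => /allP /(_ i).
    by rewrite mem_index_enum => /(_ isT) /eqP ->; rewrite scale0r.
  by move: cs; rewrite s_eq0 addr0 => ->; rewrite scale1r addr0.
have c01 : 0 <= c ord0 <= 1 by rewrite c0 -cs lerDl.
set u := \sum_(i < q) (c (lift ord0 i) / s) *: w (lift ord0 i).
have Au : A u.
  apply: IHq => [l|l|//].
  - exact: Aw.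
  - by rewrite divr_ge0.
  - by rewrite -mulr_suml divff.
have -> : \sum_(i < q) c (lift ord0 i) *: w (lift ord0 i) = s *: u.
  rewrite scaler_sumr; apply: eq_bigr => i _.
  by rewrite scalerA mulrCA divff // mulr1.
have es : s = 1 - c ord0 by rewrite -cs addrC addKr.
have /andP[c0' c1'] := c01.
have := cA (w ord0) u (Itv01 c0' c1'); rewrite !inE.
by rewrite es; apply.
Qed.

(* Homogeneous coordinates, which turn affine maps into linear ones. *)
Definition homogeneous (R : realType) (p : nat) (t : 'rV[R]_p) : 'rV[R]_(1 + p) :=
  row_mx 1%:M t.

(** The row index ['I_(1 + k)] is convertible to the vertex index ['I_k.+1] and matches the block
    shape of [homogeneous]. *)
Definition vertex_mx (R : realType) (k : nat) (v : 'I_k.+1 -> 'rV[R]_k) :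
    'M[R]_(1 + k) :=
  \matrix_(l < 1 + k) homogeneous (v l).

Lemma homogeneous_conv (R : realType) (p : nat) (a : R) (x y : 'rV[R]_p) :
  homogeneous (a *: x + (1 - a) *: y) =
  a *: homogeneous x + (1 - a) *: homogeneous y.
Proof.
rewrite /homogeneous !scale_row_mx add_row_mx -scalerDl.
by rewrite (addrC a) subrK scale1r.
Qed.

(** One product records both the total weight and the weighted sum of the vertices, the two data in
    affine independence and in convex combinations. *)
Lemma homogeneous_sum (R : realType) (k : nat) (v : 'I_k.+1 -> 'rV[R]_k)
    (c : 'I_(1 + k) -> R) :
  (\row_l c l) *m vertex_mx v =
  row_mx (\sum_l c l)%:M (\sum_l c l *: v l).
Proof.
rewrite mulmx_sum_row.
under eq_bigr => l _ do rewrite rowK mxE /homogeneous scale_row_mx.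
apply/rowP => j; rewrite summxE -[j]splitK; case: (fintype.split j) => i /=.
  rewrite row_mxEl [i]ord1 mxE eqxx mulr1n; apply: eq_bigr => l _.
  by rewrite row_mxEl !mxE eqxx mulr1.
by rewrite row_mxEr summxE; apply: eq_bigr => l _; rewrite row_mxEr.
Qed.

(** Together with [conv_hull_sub], this reduces an equality of affine maps on a hull to its
    generators. *)
Lemma convex_homogeneous_eq (R : realType) (p q : nat)
    (M N : 'M[R]_(1 + p, q)) :
  convex_set [set t | homogeneous t *m M = homogeneous t *m N].
Proof.
move=> x y a /[!inE] /= xE yE.
by rewrite homogeneous_conv !mulmxDl -!scalemxAl xE yE.
Qed.

Lemma convex_homogeneous_ge0 (R : realType) (p q : nat) (M : 'M[R]_(1 + p, q)) :
  convex_set [set t | forall l, 0 <= (homogeneous t *m M) ord0 l].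
Proof.
move=> x y a /[!inE] /= xE yE l.
rewrite homogeneous_conv !mulmxDl -!scalemxAl 2!mxE [X in _ + X]mxE.
by rewrite addr_ge0 // mulr_ge0 // subr_ge0.
Qed.

Lemma continuous_homogeneous_mul (R : realType) (p q : nat)
    (M : 'M[R]_(1 + p, q)) :
  continuous (fun t : 'rV[R]_p => homogeneous t *m M : 'rV[R]_q).
Proof.
have -> : (fun t : 'rV[R]_p => homogeneous t *m M) =
    (fun t => usubmx M + \sum_i t ord0 i *: row i (dsubmx M)).
  apply/funext => t; rewrite -[in LHS](vsubmxK M) mul_row_col mul1mx.
  by rewrite -mulmx_sum_row.
move=> t; have ft : Filter (nbhs t) by exact: nbhs_filter.
apply: (@cvgD _ _ _ (nbhs t)); first exact: cvg_cst.
apply: (@cvg_big _ _ _ _ _ _ _ (nbhs t)) => [y|i _].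
  by apply: cvgD; [exact: cvg_fst|exact: cvg_snd].
by apply: (@cvgZr_tmp _ _ _ (nbhs t)); exact: coord_continuous.
Qed.

(** For a row in the left kernel, the two blocks of [homogeneous_sum] are exactly the two premises
    of affine independence. *)
Lemma affinely_independent_unitmx (R : realType) (k : nat)
    (v : 'I_k.+1 -> 'rV[R]_k) :
  affinely_independent v -> vertex_mx v \in unitmx.
Proof.
move=> vind; rewrite -row_free_unit; apply: inj_row_free => c c0.
have cE : c = \row_l c ord0 l by apply/rowP => l; rewrite mxE.
move: c0; rewrite cE homogeneous_sum => c0.
have /matrixP/(_ ord0 ord0) := congr1 lsubmx c0.
rewrite row_mxKl linear0 !mxE eqxx mulr1n => s0.
have := congr1 rsubmx c0; rewrite row_mxKr linear0 => t0.
by apply/rowP => l; rewrite !mxE; exact: vind s0 t0 l.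
Qed.

(* The vertices of any simplex spanning the same hull are affine combinations
   of the v l, so their matrix factors through vertex_mx v. *)
Lemma simplex_unitmx (R : realType) (k : nat) (v : 'I_k.+1 -> 'rV[R]_k) :
  is_simplex k (conv_hull (range v)) -> vertex_mx v \in unitmx.
Proof.
case=> w /affinely_independent_unitmx wU wE.
suff : (vertex_mx w <= vertex_mx v)%MS.
  move/mxrankS; rewrite (mxrank_unit wU) => r.
  by rewrite -row_free_unit -row_leq_rank.
apply/row_subP => l; rewrite rowK.
have : conv_hull (range v) (w l) by rewrite wE; apply: sub_conv_hull; exists l.
(* Membership in the row space is vanishing against [cokermx]; writing zero as
   [homogeneous (w l) *m 0] makes it an equality of two affine maps, to be checked at the [v i]
   only. *)
rewrite submxE -[X in _ == X](mulmx0 _ (homogeneous (w l))) => wl; apply/eqP.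
move: wl; apply: (@conv_hull_sub _ _ _
  [set t | homogeneous t *m cokermx (vertex_mx v) = homogeneous t *m 0]);
  last exact: convex_homogeneous_eq.
move=> _ [i _ <-] /=; rewrite mulmx0.
have -> : homogeneous (v i) = row (i : 'I_(1 + k)) (vertex_mx v) by rewrite rowK.
by rewrite -row_mul mulmx_coker row0.
Qed.

(** For invertible [vertex_mx v], this is the unique row [c] with
    [c *m vertex_mx v = homogeneous t]. It is defined for every [t], with some negative entry
    outside the simplex. *)
Definition barycentric (R : realType) (k : nat) (v : 'I_k.+1 -> 'rV[R]_k)
    (t : 'rV[R]_k) : 'rV[R]_(1 + k) :=
  homogeneous t *m invmx (vertex_mx v).

Lemma barycentricE (R : realType) (k : nat) (v : 'I_k.+1 -> 'rV[R]_k)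
    (c : 'I_k.+1 -> R) :
  vertex_mx v \in unitmx -> \sum_l c l = 1 ->
  barycentric v (\sum_l c l *: v l) = \row_l c l.
Proof.
move=> vU c1; rewrite /barycentric /homogeneous -[in 1%:M]c1.
by rewrite -(homogeneous_sum v (c : 'I_(1 + k) -> R)) mulmxK.
Qed.

Lemma barycentric_vertex (R : realType) (k : nat) (v : 'I_k.+1 -> 'rV[R]_k) l :
  vertex_mx v \in unitmx -> barycentric v (v l) = delta_mx ord0 l.
Proof.
move=> vU; rewrite /barycentric.
have -> : homogeneous (v l) = row (l : 'I_(1 + k)) (vertex_mx v) by rewrite rowK.
by rewrite -row_mul mulmxV // row1.
Qed.

(** The half-space description of a simplex. The vertices have unit rows as coordinates; conversely,
    the first block of [homogeneous_sum] forces the coordinates to sum to 1. *)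
Lemma conv_hull_barycentric (R : realType) (k : nat)
    (v : 'I_k.+1 -> 'rV[R]_k) :
  vertex_mx v \in unitmx ->
  conv_hull (range v) = [set t | forall l, 0 <= barycentric v t ord0 l].
Proof.
move=> vU; apply/seteqP; split.
  apply: conv_hull_sub; last exact: convex_homogeneous_ge0.
  by move=> _ [i _ <-] l; rewrite barycentric_vertex // mxE; case: eqP.
move=> t t0.
have : (\row_l barycentric v t ord0 l) *m vertex_mx v = homogeneous t.
  have -> : \row_l barycentric v t ord0 l = barycentric v t.
    by apply/rowP => l; rewrite mxE.
  by rewrite mulmxKV.
rewrite homogeneous_sum => /eq_row_mx[/matrixP /(_ ord0 ord0)].
rewrite !mxE eqxx !mulr1n => s1 <-.
apply: convex_set_sum => //; first exact: conv_hull_convex.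
by move=> l; apply: sub_conv_hull; exists l.
Qed.

Lemma closed_conv_hull_simplex (R : realType) (k : nat)
    (v : 'I_k.+1 -> 'rV[R]_k) :
  vertex_mx v \in unitmx -> closed (conv_hull (range v)).
Proof.
move=> vU; rewrite conv_hull_barycentric //.
have -> : [set t | forall l, 0 <= barycentric v t ord0 l] =
    \bigcap_l ((fun t => barycentric v t ord0 l) @^-1` [set x | 0 <= x]).
  by apply/seteqP; split=> t tA l => [_|]; [exact: tA l|exact: tA l I].
apply: closed_bigI => l _; apply: preimage_closed; last exact: closed_ge.
move=> t _; apply: (@continuous_comp _ _ _ (barycentric v)
  (fun M : 'rV[R]_(1 + k) => M ord0 l)).
  exact: continuous_homogeneous_mul.
exact: coord_continuous.
Qed.

(** Near [t0], each piece containing [t0] is handled by continuity of its [g i], and each other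
    piece, being closed, is avoided by a neighbourhood. Finiteness of [I] lets these neighbourhoods
    be intersected. *)
Lemma continuous_within_finite_closed_cover (T U : topologicalType)
    (I : finType) (D : set T) (A : I -> set T) (g : I -> T -> U) (h : T -> U) :
  (forall i, closed (A i)) -> D `<=` \bigcup_i A i ->
  (forall i, continuous (g i)) -> (forall i t, D t -> A i t -> h t = g i t) ->
  {within D, continuous h}.
Proof.
move=> cA DA cg hg; apply/subspace_continuousP => t0 Dt0 W Wh.
have near_each : forall i, \forall t \near t0, D t -> A i t -> W (h t).
  move=> i; have [At0|nAt0] := pselect (A i t0).
    have : \forall t \near t0, W (g i t) by apply: cg; rewrite -(hg i).
    by apply: filterS => t Wt Dt At; rewrite (hg i).
  have : nbhs t0 (~` A i) by apply: open_nbhs_nbhs; split=> //; exact: closed_openC.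
  by apply: filterS => t nAt _ /nAt.
apply: filterS (filter_forall _ near_each) => t Wt Dt.
by have [i _ Ait] := DA _ Dt; exact: Wt Dt Ait.
Qed.

Theorem theorem3p1 (R : realType) (n k : nat)
  (X : set 'rV[R]_n) (Theta : set 'rV[R]_k)
  (f : 'rV[R]_n * 'rV[R]_k -> R)
  (C : 'rV[R]_k -> set 'rV[R]_n)
  (f_cont : {within X `*` Theta, continuous f})
  (C_nonempty : forall t, Theta t -> C t !=set0)
  (C_compact : forall t, Theta t -> compact (C t))
  (C_sub : forall t, Theta t -> C t `<=` X)
  (C_cont : continuous_correspondence Theta C)
  (m : nat) (theta : 'I_m -> 'rV[R]_k)
  (theta_in : forall i, Theta (theta i))
  (xstar : 'rV[R]_k -> 'rV[R]_n)
  (xstar_opt : forall i, opt_set f C (theta i) (xstar (theta i)))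
  (d : nat) (S_ : 'I_d -> set 'rV[R]_k)
  (S_sub : forall j, S_ j `<=` range theta)
  (S_card : forall j, S_ j #= `I_k.+1)
  (S_simplex : forall j, is_simplex k (conv_hull (S_ j)))
  (S_cover : conv_hull (range theta) = \bigcup_j conv_hull (S_ j))
  (S_inter : forall J : set 'I_d, J !=set0 ->
     \bigcap_(j in J) conv_hull (S_ j) = conv_hull (\bigcap_(j in J) S_ j))
  (v : 'I_d -> 'I_k.+1 -> 'rV[R]_k)
  (v_enum : forall j, S_ j = range (v j))
  (jt : 'rV[R]_k -> 'I_d)
  (jt_in : forall t, conv_hull (range theta) t -> conv_hull (S_ (jt t)) t)
  (lam : 'rV[R]_k -> 'I_k.+1 -> R)
  (lam_ge0 : forall t, conv_hull (range theta) t -> forall l, 0 <= lam t l)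
  (lam_sum : forall t, conv_hull (range theta) t -> \sum_l lam t l = 1)
  (lam_bary : forall t, conv_hull (range theta) t ->
     t = \sum_l lam t l *: v (jt t) l) :
  {within conv_hull (range theta),
    continuous (fun t : 'rV[R]_k => \sum_l lam t l *: xstar (v (jt t) l))}.
Proof.
have vU j : vertex_mx (v j) \in unitmx.
  by apply: simplex_unitmx; rewrite -v_enum.
pose Y j : 'M[R]_(1 + k, n) := \matrix_(l < 1 + k) xstar (v j l).
pose g j t : 'rV[R]_n := homogeneous t *m (invmx (vertex_mx (v j)) *m Y j).
(* The value at a vertex does not depend on [j], because [xstar] is a function of the point. *)
have g_vertex j s : S_ j s -> g j s = xstar s.
  rewrite v_enum => -[l _ <-].
  by rewrite /g mulmxA -/(barycentric _ _) barycentric_vertex // -rowE rowK.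
have g_agree i j t : conv_hull (S_ i) t -> conv_hull (S_ j) t -> g i t = g j t.
  move=> ti tj; pose J := [set i; j].
  have J0 : J !=set0 by exists i; left.
  have : (\bigcap_(l in J) conv_hull (S_ l)) t by move=> l [] ->.
  (* Now [t] lies in the hull of the common vertices, where both maps equal [xstar]; without common
     vertices this hull is empty. *)
  rewrite S_inter // => {ti tj}; move: t; apply: conv_hull_sub; last first.
    exact: convex_homogeneous_eq.
  by move=> s sJ /=; rewrite -!/(g _ _) !g_vertex //; apply: sJ; [right|left].
apply: (@continuous_within_finite_closed_cover _ _ _ _
  (fun j => conv_hull (S_ j)) g).
- by move=> j; rewrite v_enum; exact: closed_conv_hull_simplex.
- by rewrite S_cover.
- by move=> j; exact: continuous_homogeneous_mul.
(* Agreement on overlaps removes the dependence on the choice [jt]; uniqueness of barycentric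
   coordinates then identifies them with [lam t]. *)
move=> j t Dt tj; rewrite -(g_agree (jt t)) //; last exact: jt_in.
have := barycentricE (vU (jt t)) (lam_sum _ Dt); rewrite -lam_bary // => tE.
rewrite /g mulmxA -/(barycentric _ _) tE.
by rewrite mulmx_sum_row; apply: eq_bigr => l _; rewrite rowK mxE.
Qed.
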